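(* Let $d$ be a constant, let $\beta>0$ be a fixed constant, and let $\mathcal{P}$ be a set of stochastic points in $\mathbb{R}^d$ in the existential uncertainty model such that $p_v\ge\beta$ for every $v\in\mathcal{P}$. Then for every $\varepsilon>0$ there is an $\varepsilon$-exp-kernel of $\mathcal{P}$ of size $O\!\left(\frac{1}{\varepsilon^{(d-1)/2}}\log\frac{1}{\varepsilon}\right)$ which satisfies the subset constraint.
   Context: Existential model: each $v\in\mathcal{P}$ is present in a random realization $P\sim\mathcal{P}$ independently with probability $p_v$. For a finite point set $P$, $f(P,u)=\max_{p\in P}\langle u,p\rangle$ (with $f(\emptyset,u)=0$), $\omega(P,u)=f(P,u)+f(P,-u)$, and $\omega(\mathcal{P},u)=\mathbb{E}_{P\sim\mathcal{P}}[\omega(P,u)]$. A set $S$ of stochastic points is an $\varepsilon$-exp-kernel of $\mathcal{P}$ if $(1-\varepsilon)\omega(\mathcal{P},u)\le\omega(S,u)\le\omega(\mathcal{P},u)$ for all $u\in\mathbb{R}^d$. The subset constraint requires that $S$ be a subset of $\mathcal{P}$ in which each chosen point keeps its original existence probability (independently). *)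

(* Defs.v *)
From HB Require Import structures.
From mathcomp Require Export all_boot all_order all_algebra.
From mathcomp Require Export finmap.
From mathcomp Require Export all_classical all_reals all_analysis.

Set Implicit Arguments.
Unset Strict Implicit.
Unset Printing Implicit Defensive.

Import Order.TTheory GRing.Theory Num.Theory.
Import numFieldNormedType.Exports.

Local Open Scope ring_scope.

Definition dot (R : realType) (d : nat) (u v : 'rV[R]_d) : R :=
  \sum_(i < d) u ord0 i * v ord0 i.

(* The maximum may be negative, so it is folded from the value at the first
   point and not from 0; only the empty set gets the default 0. *)
Definition support_fun (R : realType) (d : nat)
    (P : {fset 'rV[R]_d}) (u : 'rV[R]_d) : R :=
  if enum_fset P is v :: s then \big[Num.max/dot u v]_(w <- s) dot u w else 0.

Definition width (R : realType) (d : nat)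
    (P : {fset 'rV[R]_d}) (u : 'rV[R]_d) : R :=
  support_fun P u + support_fun P (- u).

(* A finite set of stochastic points in the existential model. Its elements
   are labels carrying a location and an existence probability, so that two
   different stochastic points are allowed to share a location; a plain set of
   points of R^d is the case where [loc] is injective. *)
Record stoch_points (R : realType) (d : nat) := StochPoints {
  stoch_label :> finType;
  loc : stoch_label -> 'rV[R]_d;
  prob : stoch_label -> R;
  prob_itv : forall v, 0 <= prob v <= 1
}.

(* Probability that exactly the points of [A] are present. *)
Definition realization_prob (R : realType) (d : nat) (P : stoch_points R d)
    (A : {set P}) : R :=
  (\prod_(v in A) prob v) * (\prod_(v in ~: A) (1 - prob v)).

Definition realization (R : realType) (d : nat) (P : stoch_points R d)
    (A : {set P}) : {fset 'rV[R]_d} :=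
  [fset loc v | v in A]%fset.

Definition expect (R : realType) (d : nat) (P : stoch_points R d)
    (X : {fset 'rV[R]_d} -> R) : R :=
  \sum_(A : {set P}) realization_prob A * X (realization A).

Definition exp_width (R : realType) (d : nat) (P : stoch_points R d)
    (u : 'rV[R]_d) : R :=
  expect P (fun A => width A u).

Definition exp_kernel (R : realType) (d : nat) (eps : R)
    (S P : stoch_points R d) : Prop :=
  forall u : 'rV[R]_d,
    (1 - eps) * exp_width P u <= exp_width S u <= exp_width P u.

(* [S] is a subset of [P], the inclusion [h] preserving locations and existence
   probabilities; independence within [S] is built into [expect]. *)
Definition subset_constraint (R : realType) (d : nat)
    (S P : stoch_points R d) : Prop :=
  exists h : S -> P,
    [/\ injective h,
        forall v, loc (h v) = loc v
      & forall v, prob (h v) = prob v].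

(* Main.v *)
(** The stochastic kernel is obtained by peeling: extract a deterministic
    [eta]-kernel of size O(eta^(-(d-1)/2)) from the points, remove it, and repeat
    [k] times. Fix a direction [u] and let [W] be the width of the whole point set.
    If the extreme point of a realization was not peeled off, then each of the [k]
    layers holds a point that is at most [eta W] less extreme, and with probability
    at least 1 - (1-beta)^k one of these points is present. Hence the expected
    width drops by at most 2 (eta + (1-beta)^k) W, while it is at least beta^2 W
    because both extreme points are present with probability at least beta^2. So
    eta ~ eps and k ~ log (1/eps) suffice.

    For the deterministic kernel, writing the points in a basis chosen by
    elimination with maximal pivots makes their coordinates bounded while the width
    dominates the coordinates of the direction; then one keeps a nearest point of
    every node of a grid of mesh ~ sqrt eta on the boundary of a cube. *)

Require Import Defs.
From HB Require Import structures.
From mathcomp Require Import all_boot all_order all_algebra.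
From mathcomp Require Import finmap.
From mathcomp Require Import all_classical all_reals all_analysis.
From mathcomp Require Import fintype finset ring lra.
Import Order.TTheory GRing.Theory Num.Theory.
Import numFieldNormedType.Exports.

Set Implicit Arguments.
Unset Strict Implicit.
Unset Printing Implicit Defensive.

Local Open Scope ring_scope.

(** * Bilinearity of the dot product and the nearest-point inequality *)

Section Dot.
Variables (R : realType) (d : nat).
Implicit Types u v w : 'rV[R]_d.

Lemma dotDr u v w : dot u (v + w) = dot u v + dot u w.
Proof. by rewrite /dot -big_split; apply: eq_bigr => i _; rewrite mxE mulrDr. Qed.

Lemma dotDl u v w : dot (u + v) w = dot u w + dot v w.
Proof. by rewrite /dot -big_split; apply: eq_bigr => i _; rewrite mxE mulrDl. Qed.

Lemma dotZr u a v : dot u (a *: v) = a * dot u v.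
Proof. by rewrite /dot mulr_sumr; apply: eq_bigr => i _; rewrite mxE mulrCA. Qed.

Lemma dotZl u a v : dot (a *: u) v = a * dot u v.
Proof. by rewrite /dot mulr_sumr; apply: eq_bigr => i _; rewrite mxE mulrA. Qed.

Lemma dotNl u v : dot (- u) v = - dot u v.
Proof. by rewrite -scaleN1r dotZl mulN1r. Qed.

Lemma dotNr u v : dot u (- v) = - dot u v.
Proof. by rewrite -scaleN1r dotZr mulN1r. Qed.

Lemma dotBr u v w : dot u (v - w) = dot u v - dot u w.
Proof. by rewrite dotDr dotNr. Qed.

Lemma dotC u v : dot u v = dot v u.
Proof. by apply: eq_bigr => i _; rewrite mulrC. Qed.

Lemma dotvv_ge0 u : 0 <= dot u u.
Proof. by apply: sumr_ge0 => i _; rewrite -expr2 sqr_ge0. Qed.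

Lemma dot_sumr (I : finType) u (F : I -> 'rV[R]_d) :
  dot u (\sum_i F i) = \sum_i dot u (F i).
Proof.
rewrite /dot exchange_big; apply: eq_bigr => i _ /=.
by rewrite summxE mulr_sumr.
Qed.

Lemma dotvv_le_sqr u c : (forall i, `|u ord0 i| <= c) -> dot u u <= d%:R * c ^+ 2.
Proof.
move=> uc; rewrite /dot mulr_natl -[d in _ *+ d]card_ord -sumr_const.
apply: ler_sum => i _; rewrite -expr2 -real_normK ?num_real//.
by rewrite lerXn2r ?nnegrE// (le_trans (normr_ge0 _) (uc i)).
Qed.

(* If [b] is at least as close as [a] to a point [a + t u + e] lying at distance
   [|e|] from the ray issued from [a] in direction [u], then [b] is almost as
   extreme as [a] in that direction, with an error quadratic in [|e|]. *)
Lemma nearest_point_dot (t : R) u e a b : 0 < t ->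
  dot (a + t *: u + e - b) (a + t *: u + e - b) <= dot (t *: u + e) (t *: u + e) ->
  dot u a - dot u b <= dot e e / (2 * t).
Proof.
move=> t0; set z := t *: u + e; set w := a - b.
have -> : a + t *: u + e - b = z + w by apply/rowP => i; rewrite !mxE; ring.
have zw : dot z w = t * dot u w + dot w e by rewrite dotDl dotZl (dotC e w).
rewrite -dotBr -/w; clearbody z w.
rewrite !(dotDl, dotDr) (dotC w z) => h.
(* The hypothesis reads [2 t u.w <= - 2 w.e - |w|^2], and [|w + e|^2 >= 0] bounds the right-hand
   side by [|e|^2]. *)
have := dotvv_ge0 (w + e); rewrite !(dotDl, dotDr) (dotC e w) => h2.
by rewrite ler_pdivlMr ?mulr_gt0//; nra.
Qed.

End Dot.

(** * Deterministic kernels *)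

Section Kernel.
Variable R : realType.

(* Gaussian elimination in which the pivot is the entry of largest absolute
   value: all multipliers are then at most 1. *)
Lemma bounded_coordinates_aux (m d : nat) : (d <= m)%N ->
  exists2 C : R, 0 <= C &
  forall (I : finType) (D : {set I}) (p : I) (x : I -> 'rV[R]_m), p \in D ->
    (forall i (j : 'I_m), i \in D -> (d <= j)%N -> x i ord0 j = 0) ->
  exists (v : nat -> I) (l : I -> nat -> R),
    [/\ forall k, v k \in D,
        forall i k, i \in D -> `|l i k| <= C
      & forall i, i \in D -> x i = \sum_(k < d) l i k *: x (v k)].
Proof.
elim: d => [_|d IHd dm].
  exists 0 => // I D p x pD x0; exists (fun=> p), (fun _ _ => 0).
  split=> // [i k _|i iD]; first by rewrite normr0.
  by rewrite big_ord0; apply/rowP => j; rewrite mxE x0.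
have [C C0 {}IHd] := IHd (ltnW dm).
have C10 : 0 <= 1 + d%:R * C + C by rewrite !addr_ge0 ?mulr_ge0.
(* The coefficient on the new pivot is at most [1 + d C]; the last [C] covers the coefficients that
   come from the induction. *)
exists (1 + d%:R * C + C) => // I D p x pD x0.
pose jd := Ordinal dm.
case: (@arg_maxP _ _ _ p (mem D) (fun i => `|x i ord0 jd|) pD) => q qD qmax.
(* If the largest entry is 0, the whole column vanishes on [D], and division by 0 yields the correct
   multiplier 0. *)
pose mu i := x i ord0 jd / x q ord0 jd.
have mu1 i : i \in D -> `|mu i| <= 1.
  move=> iD; rewrite normrM normfV.
  have [->|nz] := eqVneq (x q ord0 jd) 0; first by rewrite normr0 invr0 mulr0.
  by rewrite ler_pdivrMr ?normr_gt0// mul1r; apply: qmax.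
have xmu i : i \in D -> x i ord0 jd = mu i * x q ord0 jd.
  move=> iD; rewrite /mu; have [z|nz] := eqVneq (x q ord0 jd) 0; last by rewrite divfK.
  apply/eqP; rewrite z mulr0 -normr_le0.
  by have := qmax i iD; rewrite /= z normr0.
have [i j iD dj|v [l [vD lC xE]]] := IHd I D p (fun i => x i - mu i *: x q) pD.
  rewrite !mxE; have [jd'|ndj] := eqVneq j jd; first by rewrite jd' xmu// subrr.
  have dj' : (d < j)%N by rewrite ltn_neqAle dj andbT eq_sym -(inj_eq val_inj) in ndj *.
  by rewrite !x0// mulr0 subrr.
exists (fun k => if k == d then q else v k).
(* Induction expands [x i - mu i *: x q] in the reduced vectors [x (v k) - mu (v k) *: x q]; all
   multiples of [x q] are collected in one coefficient. *)
exists (fun i k => if k == d then mu i - \sum_(k < d) l i k * mu (v k) else l i k).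
split=> [k|i k iD|i iD].
- by case: ifP.
- case: ifP => _; last by rewrite (le_trans (lC i k iD))// lerDr addr_ge0// mulr_ge0.
  rewrite (le_trans (ler_normB _ _))// -addrA lerD ?mu1//.
  rewrite (le_trans (ler_norm_sum _ _ _))// -[leLHS]addr0 lerD//.
  rewrite mulr_natl -[d in _ *+ d]card_ord -sumr_const; apply: ler_sum => j _.
  by rewrite normrM -[leRHS]mulr1 ler_pM ?lC ?mu1.
rewrite big_ord_recr /= eqxx.
under eq_bigr => k _ do rewrite ltn_eqF//.
have /eqP := xE i iD; rewrite /= subr_eq => /eqP {1}->.
under eq_bigr => k _ do rewrite scalerBr scalerA.
rewrite sumrB scalerBl -addrA -scaler_suml; congr (_ + _).
by rewrite addrC.
Qed.

Lemma bounded_coordinates (d : nat) :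
  exists2 C : R, 0 <= C &
  forall (I : finType) (D : {set I}) (p : I) (x : I -> 'rV[R]_d), p \in D ->
  exists (v : 'I_d -> I) (l : I -> 'rV[R]_d),
    [/\ forall k, v k \in D,
        forall i k, i \in D -> `|l i ord0 k| <= C
      & forall i, i \in D -> x i = \sum_k l i ord0 k *: x (v k)].
Proof.
have [C C0 H] := bounded_coordinates_aux (leqnn d); exists C => // I D p x pD.
have [i j _|v [l [vD lC xE]]] := H I D p x pD; first by rewrite leqNgt ltn_ord.
exists (fun k => v k), (fun i => \row_k l i k); split=> [//|i k iD|i iD].
  by rewrite mxE lC.
by rewrite xE//; apply: eq_bigr => k _; rewrite mxE.
Qed.

(** The [n.+1] equally spaced nodes of the interval from [- M] to [M], both ends included. *)
Definition grid_point (M : R) (n m : nat) : R := - M + 2 * M / n%:R * m%:R.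

Lemma grid_point_near (M x : R) (n : nat) : 0 < M -> (0 < n)%N -> `|x| <= M ->
  exists m : 'I_n.+1, `|grid_point M n m - x| <= 2 * M / n%:R.
Proof.
move=> M0 n0 xM; rewrite -(ltr_nat R) in n0.
have s0 : 0 < 2 * M / n%:R by rewrite divr_gt0// mulr_gt0.
move: xM; rewrite ler_norml => /andP[x1 x2].
set s := 2 * M / n%:R in s0 *.
have y0 : 0 <= (x + M) / s by rewrite divr_ge0 ?(ltW s0)//; lra.
have /andP[m1 m2] := truncn_itv y0.
set m := Num.truncn ((x + M) / s) in m1 m2.
have mn : (m < n.+1)%N.
  rewrite ltnS -(ler_nat R) (le_trans m1)// ler_pdivrMr// /s mulrC divfK ?gt_eqF//.
  by lra.
exists (Ordinal mn); rewrite /grid_point -/s /=.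
move: m1 m2; rewrite ler_pdivlMr// ltr_pdivrMr// -natr1 => m1 m2.
by rewrite ler_norml; apply/andP; split; lra.
Qed.

(* The net is a grid on the [2 d.+1] faces of a cube around the points, and [S]
   collects a nearest point of every node. The ray from [l i] in direction [u]
   meets the face transverse to the largest coordinate [k] of [u]; there it is
   close to a node, so [nearest_point_dot] applies. *)
Lemma bounded_kernel (d : nat) (C : R) : 0 <= C ->
  exists2 K : R, 0 <= K &
  forall (I : finType) (D : {set I}) (p : I) (l : I -> 'rV[R]_d.+1) (n : nat),
    (0 < n)%N -> p \in D -> (forall i k, i \in D -> `|l i ord0 k| <= C) ->
  exists S : {set I},
    [/\ S \subset D, (#|S| <= 2 * d.+1 * n.+1 ^ d)%N
      & forall (u : 'rV[R]_d.+1) (h : R) i, (forall k, `|u ord0 k| <= h) -> i \in D ->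
        exists2 j, j \in S & dot u (l i) - dot u (l j) <= K / n%:R ^+ 2 * h].
Proof.
(* The faces lie at height [L], at distance at least 1 from the points; before reaching its face a
   ray moves each coordinate by at most [L + C], so [M] bounds the point where it hits. *)
move=> C0; pose L := C + 1; pose M := L + 2 * C.
have M0 : 0 < M by rewrite /M /L; lra.
exists (d.+1%:R * (2 * M) ^+ 2 / 2); first by rewrite divr_ge0// mulr_ge0// sqr_ge0.
move=> I D p l n n0 pD lC.
pose y (z : bool * 'I_d.+1 * {ffun 'I_d -> 'I_n.+1}) : 'rV[R]_d.+1 :=
  \row_k (if unlift z.1.2 k is Some m then grid_point M n (z.2 m)
          else (-1) ^+ z.1.1 * L).
pose phi z := [arg min_(i < p in D) dot (y z - l i) (y z - l i)]%O.
have phiP z : phi z \in D /\ forall i, i \in D ->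
    dot (y z - l (phi z)) (y z - l (phi z)) <= dot (y z - l i) (y z - l i).
  rewrite /phi.
  by case: (@arg_minP _ _ _ p (mem D) (fun i => dot (y z - l i) (y z - l i)) pD).
exists [set phi z | z in predT]; split.
- by apply/subsetP => _ /imsetP[z _ ->]; case: (phiP z).
- rewrite (leq_trans (leq_imset_card _ _))// cardT -cardE !card_prod card_bool.
  by rewrite card_ffun !card_ord.
move=> u h i uh iD.
have n0' : 0 < n%:R :> R by rewrite ltr0n.
case: (@arg_maxP _ _ _ ord0 predT (fun k => `|u ord0 k|) isT) => k _ kmax.
have [uk0|uk0] := eqVneq (u ord0 k) 0.
  pose z : bool * 'I_d.+1 * {ffun 'I_d -> 'I_n.+1} := (true, ord0, [ffun=> ord0]).
  exists (phi z); first by rewrite imset_f.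
  have u0 : u = 0.
    apply/rowP => m; rewrite mxE; apply/eqP; rewrite -normr_le0.
    by have := kmax m isT; rewrite /= uk0 normr0.
  rewrite -dotBr u0 /dot big1 => [|m _]; last by rewrite mxE mul0r.
  rewrite mulr_ge0 ?(le_trans (normr_ge0 _) (uh k))// divr_ge0 ?sqr_ge0//.
  by rewrite divr_ge0// mulr_ge0// sqr_ge0.
pose s := u ord0 k < 0.
have us : u ord0 k = (-1) ^+ s * `|u ord0 k| by rewrite -realEsign ?num_real.
have ss : (-1) ^+ s * (-1) ^+ s = 1 :> R by rewrite -expr2 sqrr_sign.
set a := `|u ord0 k| in us; have a0 : 0 < a by rewrite normr_gt0.
pose c := (-1) ^+ s * l i ord0 k.
have cC : `|c| <= C by rewrite normrMsign lC.
(* The time at which the ray meets the face, [c] being the coordinate of [l i] in the outward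
   direction of that face. *)
pose t := (L - c) / a.
have /andP[c1 c2] : - C <= c <= C by rewrite -ler_norml.
have t0 : 0 < t by rewrite divr_gt0// /L; lra.
pose x := l i + t *: u.
have xk : x ord0 k = (-1) ^+ s * L.
  rewrite !mxE us mulrCA /t divfK ?gt_eqF// mulrBr /c mulrA ss mul1r.
  by rewrite addrC subrK.
have xM m : `|x ord0 m| <= M.
  rewrite !mxE (le_trans (ler_normD _ _))// normrM (gtr0_norm t0).
  have : t * `|u ord0 m| <= t * a by rewrite ler_pM2l//; apply: kmax.
  rewrite {2}/t divfK ?gt_eqF// => tu; have := lC i m iD.
  by rewrite /M; lra.
pose f := [ffun m : 'I_d => projT1 (cid (grid_point_near M0 n0 (xM (lift k m))))].
pose z := (s, k, f); exists (phi z); first by rewrite imset_f.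
pose e := y z - x.
(* There is no error in the transverse coordinate, since the node and [x] lie on the same face. *)
have eb m : `|e ord0 m| <= 2 * M / n%:R.
  rewrite /e /y !mxE /=; case: unliftP => [m' ->|->].
    have -> : l i ord0 (lift k m') + t * u ord0 (lift k m') = x ord0 (lift k m').
      by rewrite !mxE.
    by rewrite ffunE; case: cid.
  have -> : l i ord0 k + t * u ord0 k = x ord0 k by rewrite !mxE.
  by rewrite xk subrr normr0 divr_ge0 ?ltW// mulr_gt0.
have yE : y z = l i + t *: u + e by rewrite /e /x addrC subrK.
have := (phiP z).2 i iD; rewrite {3 4}yE.
have -> : l i + t *: u + e - l i = t *: u + e by rewrite addrC -addrA addKr.
rewrite yE => /(nearest_point_dot t0) /le_trans; apply.
have ee := dotvv_le_sqr eb.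
(* The gap of 1 between points and faces is used here: [L - c >= 1]. *)
have ht : t^-1 <= h.
  rewrite /t invf_div ler_pdivrMr; last by rewrite /L; lra.
  rewrite (le_trans (uh k))// ler_peMr ?(le_trans (normr_ge0 _) (uh k))// /L; lra.
rewrite invfM mulrA; apply: ler_pM => //.
- by rewrite divr_ge0// dotvv_ge0.
- by rewrite invr_ge0 ltW.
rewrite ler_pdivrMr// (le_trans ee)// expr_div_n.
by rewrite le_eqVlt; apply/orP; left; apply/eqP; field; rewrite gt_eqF.
Qed.

(** In the coordinates of [bounded_coordinates], relative to a base point [p], the points become
    bounded and [u] becomes the vector [w] of its values on differences of points. These values are
    at most [W], so the absolute error of [bounded_kernel] turns into an error relative to the
    width. *)
Lemma kernel_exists (d : nat) :
  exists2 K : R, 0 <= K &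
  forall (I : finType) (D : {set I}) (x : I -> 'rV[R]_d.+1) (n : nat),
    (0 < n)%N -> D != set0 ->
  exists S : {set I},
    [/\ S \subset D, (#|S| <= 2 * d.+1 * n.+1 ^ d)%N
      & forall (u : 'rV[R]_d.+1) (W : R),
        (forall a b, a \in D -> b \in D -> dot u (x a) - dot u (x b) <= W) ->
        exists2 j, j \in S & forall i, i \in D ->
          dot u (x i) - dot u (x j) <= K / n%:R ^+ 2 * W].
Proof.
have [C C0 coords] := bounded_coordinates d.+1.
have [K K0 ker] := bounded_kernel d C0; exists K => // I D x n n0 /set0Pn[p pD].
have [v [l [vD lC xE]]] := coords I D p (fun i => x i - x p) pD.
have [S [SD cardS kerS]] := ker I D p l n n0 pD lC.
exists S; split=> // u W uW.
pose w : 'rV[R]_d.+1 := \row_k dot u (x (v k) - x p).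
have dotw i : i \in D -> dot u (x i) = dot w (l i) + dot u (x p).
  move=> iD; apply/eqP; rewrite -subr_eq -dotBr xE// dot_sumr; apply/eqP.
  by apply: eq_bigr => k _; rewrite mxE dotZr mulrC.
have wW k : `|w ord0 k| <= W.
  by rewrite mxE dotBr ler_norml lerNl opprB !uW.
have [j0 j0S _] := kerS w W p wW pD.
(* [bounded_kernel] gives a [j] depending on [i]; the most extreme point of [S] serves every [i] at
   once. *)
case: (@arg_maxP _ _ _ j0 (mem S) (fun i => dot u (x i)) j0S) => j jS jmax.
exists j => // i iD; have [k kS ik] := kerS w W i wW iD.
have kD := subsetP SD k kS.
have := jmax k kS => /=; rewrite (dotw i iD) (dotw j (subsetP SD j jS)) (dotw k kD).
by lra.
Qed.

(** Each round adds a kernel of the points still outside [S], and [T] receives one good point of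
    every layer. Earlier members of [T] stay good because fewer points remain outside. The set [T]
    depends on the direction, [S] does not. *)
Lemma layered_kernel_exists (d : nat) :
  exists2 K : R, 0 <= K &
  forall (I : finType) (x : I -> 'rV[R]_d.+1) (n k : nat), (0 < n)%N ->
  exists2 S : {set I}, (#|S| <= k * (2 * d.+1 * n.+1 ^ d))%N &
    S != setT -> forall (u : 'rV[R]_d.+1) (W : R),
      (forall a b, dot u (x a) - dot u (x b) <= W) ->
    exists T : {set I},
      [/\ T \subset S, #|T| = k
        & forall i j, i \notin S -> j \in T ->
          dot u (x i) - dot u (x j) <= K / n%:R ^+ 2 * W].
Proof.
have [K K0 ker] := kernel_exists d; exists K => // I x n + n0; elim=> [|k [S cS HS]].
  exists set0 => [|_ u W _]; first by rewrite cards0.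
  by exists set0; split=> // [|i j _]; rewrite ?cards0 ?inE.
(* Once everything is peeled off, [S] is kept and the claim about [T] is vacuous. *)
have [ST|ST] := eqVneq S setT.
  exists S => [|]; last by rewrite ST eqxx.
  by rewrite (leq_trans cS)// leq_mul2r leqnSn orbT.
have D0 : ~: S != set0 by apply: contraNneq ST => SC; rewrite -(setCK S) SC setC0.
have [S' [S'D cS' HS']] := ker I (~: S) x n n0 D0.
exists (S' :|: S).
  by rewrite mulSn (leq_trans (leq_card_setU _ _))// leq_add.
move=> _ u W uW; have [T [TS cT HT]] := HS ST u W uW.
have [j jS' Hj] := HS' u W (fun a b _ _ => uW a b).
have jS : j \notin S by have := subsetP S'D j jS'; rewrite inE.
exists (j |: T); split.
- by rewrite subUset sub1set inE jS' (subset_trans TS) ?subsetUr.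
- by rewrite cardsU1 cT (contra (subsetP TS j)).
move=> i j'; rewrite !inE negb_or => /andP[_ iS] /orP[/eqP->|]; last exact: HT.
by apply: Hj; rewrite inE.
Qed.

End Kernel.

(** * Realizations and expected width *)

Section Support.
Variables (R : realType) (d : nat).
Implicit Types (X : {fset 'rV[R]_d}) (u v : 'rV[R]_d).

Lemma support_fun_ge X u v : v \in X -> dot u v <= support_fun X u.
Proof.
move=> vX; have : v \in enum_fset X := vX.
rewrite /support_fun; case: (enum_fset X) => // w s.
by rewrite inE => /predU1P[->|vs]; [exact: bigmax_ge_id|exact: le_bigmax_seq].
Qed.

Lemma support_fun_attained X u v : v \in X ->
  exists2 w, w \in X & support_fun X u = dot u w.
Proof.
move=> vX; suff [w ws ->] : exists2 w, w \in enum_fset X & support_fun X u = dot u w.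
  by exists w.
have : v \in enum_fset X := vX.
rewrite /support_fun; case: (enum_fset X) => // w s _.
elim: s => [|a s [b bs IHs]]; first by exists w; rewrite ?inE ?big_nil.
rewrite big_cons IHs; case: leP => _; last by exists a; rewrite ?inE ?eqxx ?orbT.
by exists b => //; move: bs; rewrite !inE => /orP[->|->]; rewrite ?orbT.
Qed.

End Support.

Section Realization.
Variables (R : realType) (d : nat) (P : stoch_points R d).
Implicit Types (A B T : {set P}) (u : 'rV[R]_d).

Lemma support_realization_ge A u v : v \in A ->
  dot u (loc v) <= support_fun (realization A) u.
Proof. by move=> vA; apply: support_fun_ge; rewrite in_imfset. Qed.

Lemma support_realization_attained A u : A != set0 ->
  exists2 v, v \in A & support_fun (realization A) u = dot u (loc v).
Proof.
case/set0Pn => v vA.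
have lvA : loc v \in realization A by rewrite in_imfset.
by have [w /imfsetP[x xA ->] ->] := support_fun_attained u lvA; exists x.
Qed.

Lemma support_realization0 u : support_fun (realization (set0 : {set P})) u = 0.
Proof.
rewrite /support_fun; case E: (enum_fset _) => [//|w s].
suff /imfsetP[v /=] : w \in realization (set0 : {set P}) by rewrite finset.in_set0.
by rewrite -[_ \in _]/(w \in enum_fset _) E mem_head.
Qed.

Lemma width_realization_ge A u a b : a \in A -> b \in A ->
  dot u (loc a) - dot u (loc b) <= width (realization A) u.
Proof.
by move=> aA bA; rewrite lerD// -?dotNl support_realization_ge.
Qed.

Lemma width_realization_ge0 A u : 0 <= width (realization A) u.
Proof.
have [->|[v vA]] := set_0Vmem A; first by rewrite /width !support_realization0 addr0.
by rewrite (le_trans _ (width_realization_ge u vA vA))// subrr.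
Qed.

Lemma width_realization_le A u W : 0 <= W ->
  (forall a b, a \in A -> b \in A -> dot u (loc a) - dot u (loc b) <= W) ->
  width (realization A) u <= W.
Proof.
move=> W0 uW; have [->|A0] := eqVneq A set0.
  by rewrite /width !support_realization0 addr0.
rewrite /width; have [a aA ->] := support_realization_attained u A0.
have [b bA ->] := support_realization_attained (- u) A0.
by rewrite dotNl uW.
Qed.

Lemma width_realizationS A B u : B \subset A ->
  width (realization B) u <= width (realization A) u.
Proof.
move=> /subsetP BA; apply: width_realization_le => [|a b aB bB].
  exact: width_realization_ge0.
by apply: width_realization_ge; apply: BA.
Qed.

Lemma realization_prob_ge0 A : 0 <= realization_prob A.
Proof.
by apply: mulr_ge0; apply: prodr_ge0 => v _; have /andP[] := prob_itv v;
  rewrite ?subr_ge0.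
Qed.

Lemma realization_probE A :
  realization_prob A = \prod_v (if v \in A then prob v else 1 - prob v).
Proof.
rewrite /realization_prob [RHS](bigID (mem A)) /=; congr (_ * _).
  by apply: eq_bigr => v ->.
by apply: eq_big => [v|v]; rewrite inE// => /negPf->.
Qed.

(** Independence: the expectation of a product of functions of the individual presences factors. *)
Lemma realization_prob_prod (g : P -> bool -> R) :
  \sum_(A : {set P}) realization_prob A * \prod_v g v (v \in A) =
  \prod_v (prob v * g v true + (1 - prob v) * g v false).
Proof.
rewrite bigA_distr; apply: eq_bigr => A _.
rewrite realization_probE -big_split; apply: eq_bigr => v _ /=.
by case: ifP.
Qed.

Lemma prodr_bool (I : finType) (c : pred I) :
  \prod_v (c v)%:R = ([forall v, c v]%:R : R).
Proof.
have [/forallP cT|] := boolP [forall v, c v]; first by rewrite big1// => v _; rewrite cT.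
by rewrite negb_forall => /existsP[v /negPf cv]; rewrite (bigD1 v)//= cv mul0r.
Qed.

Lemma realization_prob_event (c : P -> bool -> bool) (e : {set P} -> bool) :
    (forall A, e A = [forall v, c v (v \in A)]) ->
  \sum_(A : {set P}) realization_prob A * (e A)%:R =
  \prod_v (prob v * (c v true)%:R + (1 - prob v) * (c v false)%:R).
Proof.
move=> eE; rewrite -(realization_prob_prod (fun v b => (c v b)%:R)); apply: eq_bigr => A _.
by rewrite prodr_bool eE.
Qed.

Lemma sum_realization_prob : \sum_(A : {set P}) realization_prob A = 1.
Proof.
rewrite -[RHS](_ : \prod_v (prob (v : P) * 1 + (1 - prob v) * 1) = 1).
  rewrite -(realization_prob_prod (fun _ _ => 1)).
  by apply: eq_bigr => A _; rewrite big1_eq mulr1.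
by rewrite big1// => v _; rewrite !mulr1 addrC subrK.
Qed.

Lemma prob_disjoint T :
  \sum_(A : {set P}) realization_prob A * [disjoint T & A]%:R =
  \prod_(v in T) (1 - prob v).
Proof.
rewrite (@realization_prob_event (fun v b => (v \in T) ==> ~~ b)) => [|A].
  rewrite [RHS]big_mkcond; apply: eq_bigr => v _.
  by case: (v \in T); rewrite /= ?mulr0 ?mulr1 ?add0r// addrC subrK.
rewrite disjoint_subset; apply/subsetP/forallP => H v.
  by apply/implyP => /H; rewrite inE.
by move=> vT; have := H v; rewrite vT inE.
Qed.

Lemma prob_subset T :
  \sum_(A : {set P}) realization_prob A * (T \subset A)%:R = \prod_(v in T) prob v.
Proof.
rewrite (@realization_prob_event (fun v b => (v \in T) ==> b)) => [|A].
  rewrite [RHS]big_mkcond; apply: eq_bigr => v _.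
  by case: (v \in T); rewrite /= ?mulr0 ?mulr1 ?addr0// addrC subrK.
by apply/subsetP/forallP => H v; [apply/implyP => /H|move=> vT; have := H v; rewrite vT].
Qed.

End Realization.

(** * Restriction to a subset of the points and loss of expected width *)

Section Restriction.
Variables (R : realType) (d : nat) (P : stoch_points R d).
Implicit Types (A S T : {set P}) (u : 'rV[R]_d).

Definition restrict_points (S : {set P}) : stoch_points R d :=
  @StochPoints R d {v : P | v \in S} (fun v => loc (val v)) (fun v => prob (val v))
    (fun v => prob_itv (val v)).

Lemma restrict_points_subset S : subset_constraint (restrict_points S) P.
Proof. by exists (fun v => val v); split=> //; apply: val_inj. Qed.

Lemma card_restrict_points S : #|restrict_points S| = #|S|.
Proof. exact: card_sig. Qed.

(** A coupling: a realization of the restricted points is distributed as the trace on [S] of a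
    realization of [P]. This allows both expected widths to be compared realization by
    realization. *)
Lemma expect_restrict_points S (X : {fset 'rV[R]_d} -> R) :
  expect (restrict_points S) X =
  \sum_(A : {set P}) realization_prob A * X (realization (A :&: S)).
Proof.
pose tr A : {set restrict_points S} := [set w | val w \in A].
rewrite [RHS](partition_big tr predT)//=; apply: eq_bigr => B _.
have trE A : tr A == B -> realization (A :&: S) = realization B.
  move=> /eqP <-; apply/fsetP => x; apply/imfsetP/imfsetP => -[v /= vA ->].
    by case/setIP: vA => vA vS; exists (exist _ v vS) => //=; rewrite inE.
  by exists (val v) => //; rewrite inE (valP v) andbT; rewrite inE in vA.
under [RHS]eq_bigr => A /trE-> do [].
rewrite -mulr_suml; congr (_ * _).
rewrite realization_probE [RHS]big_mkcond.
under [RHS]eq_bigr => A _.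
  rewrite -mulrb -mulr_natr; over.
(* Having trace [B] is one condition per point of [S]; the points outside [S] contribute factors
   1. *)
rewrite (realization_prob_event
  (c := fun v b => (v \in S) ==> (b == (v \in val @: B)))) => [|A].
  rewrite [RHS](bigID (mem S)) /= [X in _ = _ * X]big1 => [|v /negPf->]; last first.
    by rewrite /= !mulr1 addrC subrK.
  rewrite mulr1 [RHS]big_sub; apply: eq_bigr => w _.
  rewrite (valP w) /= mem_imset; last exact: val_inj.
  by case: (w \in B); rewrite /= ?mulr0 ?mulr1 ?addr0 ?add0r.
apply/eqP/forallP => [<- v|H].
  apply/implyP => vS; rewrite -[v]/(val (exist (fun v => v \in S) v vS)).
  by rewrite mem_imset ?inE//; apply: val_inj.
apply/setP => w; have := H (val w); rewrite (valP w) mem_imset; last exact: val_inj.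
by rewrite inE => /eqP.
Qed.

Lemma exp_width_restrict_le S u : exp_width (restrict_points S) u <= exp_width P u.
Proof.
rewrite /exp_width expect_restrict_points; apply: ler_sum => A _.
by rewrite ler_wpM2l ?realization_prob_ge0// width_realizationS// subsetIl.
Qed.

Lemma exp_width_ge (beta : R) u (a b : P) : 0 < beta -> (forall v : P, beta <= prob v) ->
  0 <= dot u (loc a) - dot u (loc b) ->
  beta ^+ 2 * (dot u (loc a) - dot u (loc b)) <= exp_width P u.
Proof.
(* For [a = b] the set [[set a; b]] has one element only, so the product estimate below needs
   [a != b]. *)
move=> b0 bP; have [->|ab W0] := eqVneq a b.
  move=> _; rewrite subrr mulr0; apply: sumr_ge0 => A _.
  by rewrite mulr_ge0 ?realization_prob_ge0 ?width_realization_ge0.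
have : beta ^+ 2 <= \prod_(v in [set a; b]) prob v.
  by rewrite big_setU1 ?inE//= big_set1 expr2 ler_pM ?bP ?(ltW b0).
rewrite -prob_subset => /(ler_wpM2r W0) /le_trans; apply.
rewrite mulr_suml; apply: ler_sum => A _.
rewrite -mulrA ler_wpM2l ?realization_prob_ge0//.
have [/subsetP abA|_] := boolP (_ \subset A).
  by rewrite mul1r width_realization_ge// abA// !inE eqxx ?orbT.
by rewrite mul0r width_realization_ge0.
Qed.

Lemma support_loss (S T A : {set P}) u c : T \subset S -> 0 <= c ->
    (forall i j, i \notin S -> j \in T -> dot u (loc i) - dot u (loc j) <= c) ->
    ~~ [disjoint T & A] ->
  support_fun (realization A) u <= support_fun (realization (A :&: S)) u + c.
Proof.
move=> TS c0 ST /pred0Pn[j /andP[/= jT jA]].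
have A0 : A != set0 by apply/set0Pn; exists j.
have [i iA ->] := support_realization_attained u A0.
have [iS|iS] := boolP (i \in S).
  by rewrite ler_wpDr// support_realization_ge// inE iA.
have jS := subsetP TS j jT.
have : dot u (loc j) <= support_fun (realization (A :&: S)) u.
  by rewrite support_realization_ge// inE jA.
by have := ST i j iS jT; lra.
Qed.

(** If the realization meets both [T1] and [T2], each of the two supports drops by at most [c];
    otherwise the loss is at most [W], and the two products bound the probability of that by a union
    bound. *)
Lemma exp_width_loss (S T1 T2 : {set P}) u c W : T1 \subset S -> T2 \subset S ->
    0 <= c -> (forall a b : P, dot u (loc a) - dot u (loc b) <= W) -> 0 <= W ->
    (forall i j, i \notin S -> j \in T1 -> dot u (loc i) - dot u (loc j) <= c) ->
    (forall i j, i \notin S -> j \in T2 ->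
       dot (- u) (loc i) - dot (- u) (loc j) <= c) ->
  exp_width P u <= exp_width (restrict_points S) u + (2 * c +
    W * (\prod_(v in T1) (1 - prob v) + \prod_(v in T2) (1 - prob v))).
Proof.
move=> T1S T2S c0 uW W0 H1 H2.
rewrite -!prob_disjoint /exp_width expect_restrict_points.
have -> : 2 * c = \sum_(A : {set P}) realization_prob A * (2 * c).
  by rewrite -mulr_suml sum_realization_prob mul1r.
rewrite mulrDr !mulr_sumr -!big_split.
apply: ler_sum => A _ /=; have p0 := realization_prob_ge0 A.
set p := realization_prob A in p0 *.
rewrite ![W * (p * _)]mulrCA -!mulrDr; apply: ler_wpM2l => //.
have wW : width (realization A) u <= W by apply: width_realization_le.
have wS0 := width_realization_ge0 (A :&: S) u.
have [d1|n1] := boolP [disjoint T1 & A].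
  by case: [disjoint T2 & A]; rewrite /= ?mulr1n ?mulr0n; lra.
have [d2|n2] := boolP [disjoint T2 & A]; first by rewrite /= ?mulr1n ?mulr0n; lra.
have := support_loss T1S c0 H1 n1; have := support_loss T2S c0 H2 n2.
by rewrite /width /= ?mulr0n; lra.
Qed.

End Restriction.

(** * From peeled layers to a stochastic kernel *)

Lemma prod_absent_le (R : realType) (d : nat) (P : stoch_points R d) (beta : R)
    (T : {set P}) : (forall v : P, beta <= prob v) ->
  \prod_(v in T) (1 - prob v) <= expR (- beta * #|T|%:R).
Proof.
move=> bP; rewrite expRM_natr -prodr_const; apply: ler_prod => v _.
have /andP[_ p1] := prob_itv v; rewrite subr_ge0 p1 /=.
by rewrite (le_trans _ (expR_ge1Dx _))// lerD2l lerN2.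
Qed.

Lemma exp_kernel_of_layers (R : realType) (d : nat) (beta : R) : 0 < beta ->
  exists2 K : R, 0 <= K &
  forall (P : stoch_points R d.+1) (n k : nat) (eps : R), (0 < n)%N ->
    (forall v : P, beta <= prob v) ->
    2 * (K / n%:R ^+ 2 + expR (- beta * k%:R)) <= eps * beta ^+ 2 ->
  exists S : stoch_points R d.+1,
    [/\ exp_kernel eps S P, subset_constraint S P
      & (#|S| <= k * (2 * d.+1 * n.+1 ^ d))%N].
Proof.
move=> b0; have [K K0 ker] := layered_kernel_exists R d; exists K => //.
move=> P n k eps n0 bP epsP.
have [S cS HS] := ker P (@loc _ _ P) n k n0.
exists (restrict_points S); split; last by rewrite card_restrict_points.
- move=> u; rewrite exp_width_restrict_le andbT.
  have eps0 : 0 <= eps.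
    rewrite -(pmulr_lge0 _ (exprn_gt0 2 b0)) (le_trans _ epsP)// mulr_ge0//.
    by rewrite addr_ge0 ?expR_ge0// divr_ge0// sqr_ge0.
  have w0 : 0 <= exp_width P u.
    by apply: sumr_ge0 => A _; rewrite mulr_ge0 ?realization_prob_ge0 ?width_realization_ge0.
  have [ST|ST] := eqVneq S setT.
    have -> : exp_width (restrict_points S) u = exp_width P u.
      rewrite /exp_width expect_restrict_points ST.
      by apply: eq_bigr => A _; rewrite setIT.
    by rewrite ler_piMl// gerBl.
  have /set0Pn[p _] : ~: S != set0.
    by apply: contraNneq ST => SC; rewrite -(setCK S) SC setC0.
  case: (@arg_maxP _ _ _ p predT (fun i => dot u (loc i)) isT) => a _ amax.
  case: (@arg_minP _ _ _ p predT (fun i => dot u (loc i)) isT) => b _ bmin.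
  pose W := dot u (loc a) - dot u (loc b).
  have uW (i j : P) : dot u (loc i) - dot u (loc j) <= W.
    by have := amax i isT; have := bmin j isT; rewrite /= /W; lra.
  have uW' (i j : P) : dot (- u) (loc i) - dot (- u) (loc j) <= W.
    by rewrite !dotNl opprK addrC uW.
  have W0 : 0 <= W by have := uW a a; rewrite subrr.
  have [T1 [T1S cT1 H1]] := HS ST u W uW.
  have [T2 [T2S cT2 H2]] := HS ST (- u) W uW'.
  have c0 : 0 <= K / n%:R ^+ 2 * W by rewrite mulr_ge0// divr_ge0// sqr_ge0.
  have loss := exp_width_loss T1S T2S c0 uW W0 H1 H2.
  have := prod_absent_le T1 bP; have := prod_absent_le T2 bP.
  rewrite cT1 cT2 => q2 q1.
  (* The loss is at most [2 (K / n^2 + expR (- beta k)) W <= eps beta^2 W], and [beta^2 W] is at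
     most the expected width. *)
  have := ler_wpM2l W0 (lerD q1 q2).
  have := ler_wpM2r W0 epsP.
  have := ler_wpM2l eps0 (exp_width_ge b0 bP W0); rewrite -/W.
  by lra.
- exact: restrict_points_subset.
Qed.

(** * Choice of the parameters *)

Lemma truncn_le_norm (R : realType) (x : R) : (Num.truncn x)%:R <= `|x|.
Proof.
have [x0|x0] := lerP 0 x; first by rewrite ger0_norm//; case/andP: (truncn_itv x0).
have : (Num.truncn x <= 0)%N by rewrite truncn_le_nat (lt_trans x0).
by rewrite leqn0 => /eqP->.
Qed.

Section Size.
Variables (R : realType) (beta K : R).
Hypotheses (beta_gt0 : 0 < beta) (K_ge0 : 0 <= K).

(** Its square is at least [4 K / beta^2], as [grid_error] requires; the summand 1 ensures that it
    does not exceed its square. *)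
Definition grid_scale : R := 1 + 4 * K / beta ^+ 2.
Definition grid_size (eps : R) : nat := (Num.truncn (grid_scale / Num.sqrt eps)).+1.
(** Obtained by solving [expR (- beta k) = eps beta^2 / 4] for [k]. Grid and layer errors of
    [eps beta^2 / 4] each, doubled, use up the budget [eps beta^2]. *)
Definition layer_count (eps : R) : nat :=
  (Num.truncn (ln (4 / (eps * beta ^+ 2)) / beta)).+1.

Lemma grid_scale_ge1 : 1 <= grid_scale.
Proof. by rewrite lerDl divr_ge0 ?sqr_ge0 ?mulr_ge0. Qed.

Lemma grid_error (eps : R) : 0 < eps ->
  K / (grid_size eps)%:R ^+ 2 <= eps * beta ^+ 2 / 4.
Proof.
move=> e0; have b2 : 0 < beta ^+ 2 by rewrite exprn_gt0.
have c1 := grid_scale_ge1; have c0 : 0 < grid_scale by lra.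
have r0 : 0 < Num.sqrt eps by rewrite sqrtr_gt0.
have /ltW := truncnS_gt (grid_scale / Num.sqrt eps); rewrite -/(grid_size eps) => n1.
have : (grid_scale / Num.sqrt eps) ^+ 2 <= (grid_size eps)%:R ^+ 2.
  by rewrite lerXn2r ?nnegrE ?divr_ge0 ?(ltW c0) ?(ltW r0).
rewrite expr_div_n sqr_sqrtr ?(ltW e0)// ler_pdivrMr// => n2.
have n0 : 0 < (grid_size eps)%:R ^+ 2 :> R by rewrite exprn_gt0// ltr0n.
have cc : 4 * K / beta ^+ 2 <= grid_scale ^+ 2.
  by rewrite (@le_trans _ _ grid_scale)// ?lerDr// expr2 ler_peMl// ltW.
have := le_trans cc n2; rewrite ler_pdivrMr// => key.
by rewrite ler_pdivrMr//; lra.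
Qed.

Lemma layer_error (eps : R) : 0 < eps ->
  expR (- beta * (layer_count eps)%:R) <= eps * beta ^+ 2 / 4.
Proof.
move=> e0; have b2 : 0 < beta ^+ 2 by rewrite exprn_gt0.
have q0 : 0 < 4 / (eps * beta ^+ 2) by rewrite divr_gt0// mulr_gt0.
have /ltW := truncnS_gt (ln (4 / (eps * beta ^+ 2)) / beta).
rewrite -/(layer_count eps) ler_pdivrMr// => kb.
rewrite -[leRHS]invrK invf_div -[(4 / _)]lnK ?posrE// -expRN ler_expR.
by rewrite mulNr lerN2 [beta * _]mulrC.
Qed.

Lemma size_bound (d : nat) : exists2 C : R, 0 < C & forall eps : R,
  0 < eps < expR (- 1) ->
  (layer_count eps * (2 * d.+1 * (grid_size eps).+1 ^ d))%:R <=
    C * (1 / eps `^ ((d.+1%:R - 1) / 2) * ln (1 / eps)).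
Proof.
have b2 : 0 < beta ^+ 2 by rewrite exprn_gt0.
have c1 := grid_scale_ge1; set c := grid_scale in c1.
(* For [eps] below [expR (- 1)] both [ln (1 / eps)] and [1 / sqrt eps] are at least 1, so additive
   constants are absorbed into the factors [A] and [c + 2]. *)
pose A := (`|ln (4 / beta ^+ 2)| + 1) / beta + 1.
have A0 : 0 < A by rewrite ltr_wpDl// divr_ge0 ?addr_ge0// ltW.
exists (A * ((2 * d.+1)%:R * (c + 2) ^+ d)).
  by rewrite !mulr_gt0 ?ltr0n// exprn_gt0//; lra.
move=> eps /andP[e0 e1].
have lne : 1 <= ln (1 / eps).
  rewrite div1r lnV ?posrE// lerNr -[leRHS]expRK ler_ln ?posrE ?expR_gt0//.
  exact: ltW.
set L := ln (1 / eps) in lne *.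
have kA : (layer_count eps)%:R <= A * L.
  rewrite /layer_count -natr1.
  have h := truncn_le_norm (ln (4 / (eps * beta ^+ 2)) / beta).
  have hL : ln (4 / (eps * beta ^+ 2)) = ln (4 / beta ^+ 2) + L.
    rewrite -lnM ?posrE ?divr_gt0//; congr ln.
    by field; rewrite !gt_eqF.
  have : `|ln (4 / (eps * beta ^+ 2)) / beta| <= (`|ln (4 / beta ^+ 2)| + 1) / beta * L.
    rewrite normrM normfV (gtr0_norm beta_gt0) mulrAC ler_pM2r ?invr_gt0// hL.
    rewrite (le_trans (ler_normD _ _))// [leRHS]mulrDl mul1r (ger0_norm (le_trans ler01 lne)).
    by rewrite lerD2r ler_peMr.
  by move=> h2; rewrite /A [leRHS]mulrDl mul1r; lra.
have r0 : 0 < Num.sqrt eps by rewrite sqrtr_gt0.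
have r1 : Num.sqrt eps <= 1.
  by rewrite -sqrtr1 ler_wsqrtr// (le_trans (ltW e1))// -expR0 ler_expR; lra.
have nc : (grid_size eps).+1%:R <= (c + 2) / Num.sqrt eps.
  have := truncn_le_norm (grid_scale / Num.sqrt eps); rewrite -/c.
  rewrite ger0_norm; last by rewrite divr_ge0// ltW//; lra.
  have r2 : 1 <= (Num.sqrt eps)^-1 by rewrite invf_ge1.
  move=> h; rewrite /grid_size -/c -[_.+2]addn2 natrD [leRHS]mulrDl.
  by lra.
have rE : eps `^ ((d.+1%:R - 1) / 2) = Num.sqrt eps ^+ d.
  rewrite -natr1 addrK mulrC powRrM powR12_sqrt ?(ltW e0)//.
  by rewrite powR_mulrn// sqrtr_ge0.
have nd : ((grid_size eps).+1 ^ d)%:R <= (c + 2) ^+ d / Num.sqrt eps ^+ d :> R.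
  rewrite natrX -expr_div_n lerXn2r ?nnegrE// divr_ge0 ?(ltW r0)//; lra.
rewrite rE natrM natrM.
have -> : A * ((2 * d.+1)%:R * (c + 2) ^+ d) * (1 / Num.sqrt eps ^+ d * L) =
    A * L * ((2 * d.+1)%:R * ((c + 2) ^+ d / Num.sqrt eps ^+ d)).
  by rewrite div1r; ring.
by rewrite ler_pM// ler_pM2l// ltr0n.
Qed.

End Size.

(** * Dimension zero and the final bound *)

Lemma exp_width_dim0 (R : realType) (P : stoch_points R 0) u : exp_width P u = 0.
Proof.
apply: big1 => A _; suff -> : width (realization A) u = 0 by rewrite mulr0.
apply: le_anti; rewrite width_realization_ge0 andbT.
by apply: width_realization_le => // a b _ _; rewrite /dot !big_ord0 subrr.
Qed.

Local Open Scope classical_set_scope.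

Theorem mainTheorem10 (R : realType) (d : nat) (beta : R) (hbeta : 0 < beta) :
  exists g : R -> R,
    (g =O_ (0^'+) (fun eps : R =>
                    1 / (eps `^ ((d%:R - 1) / 2)) * ln (1 / eps))) /\
    (forall (P : stoch_points R d), (forall v : P, beta <= prob v) ->
     forall eps : R, 0 < eps ->
       exists S : stoch_points R d,
         [/\ exp_kernel eps S P,
             subset_constraint S P
           & (#|S|)%:R <= g eps]).
Proof.
case: d => [|d].
  (* In dimension 0 all widths vanish, so the empty set is a kernel. *)
  exists (fun=> 0); split.
    by apply/eqO_exP; exists 1 => //; near=> x; rewrite normr0 mulr_ge0.
  move=> P _ eps _; exists (restrict_points (finset.set0 : {set P})); split.
  - by move=> u; rewrite !exp_width_dim0 mulr0 lexx.
  - exact: restrict_points_subset.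
  - by rewrite card_restrict_points cards0.
have [K K0 ker] := exp_kernel_of_layers d hbeta.
(* The size bound itself serves as [g]: it depends on [eps], [beta] and the dimension, but not on
   [P]. *)
exists (fun eps => (layer_count beta eps *
  (2 * d.+1 * (grid_size beta K eps).+1 ^ d))%:R); split.
  have [C C0 sizeC] := size_bound hbeta K0 d.
  apply/eqO_exP; exists C => //; near=> eps.
  rewrite ger0_norm// (le_trans (sizeC eps _))//; last first.
    by rewrite ler_pM2l// ler_norm.
  by apply/andP; split; near: eps; [exact: nbhs_right_gt|exact/nbhs_right_lt/expR_gt0].
move=> P bP eps eps0.
have [||S [kS sS cS]] := ker P (grid_size beta K eps) (layer_count beta eps) eps _ bP.
- by [].
- by have := grid_error hbeta K0 eps0; have := layer_error hbeta eps0; lra.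
by exists S; split=> //; rewrite ler_nat.
Unshelve. all: by end_near.
Qed.
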